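(* Let $g\ge2$, let $\Gamma\subset\mathrm{Sp}(g,\mathbb Z)$ be a neat arithmetic subgroup and let $\Sigma_{\mathfrak F_0}=\{\sigma_\alpha^{\mathfrak F_0}\}$ be a $\overline{\Gamma_{\mathfrak F_0}}$-admissible (or $\mathrm{GL}(g,\mathbb Z)$-admissible) polyhedral decomposition of $C(\mathfrak F_0)$ regular with respect to $\Gamma$, where $\mathfrak F_0$ is the standard minimal cusp of the Siegel space $\mathfrak H_g$. Let $\overline{\mathcal A}_{g,\Gamma}$ be the toroidal compactification of $\mathcal A_{g,\Gamma}=\mathfrak H_g/\Gamma$ constructed by $\Sigma_{\mathfrak F_0}$. Assume that the boundary divisor $D_\infty=\overline{\mathcal A}_{g,\Gamma}\setminus\mathcal A_{g,\Gamma}$ is simple normal crossing. Then there is an injective map of sets $$\nu_\Gamma:\{\text{top-dimensional cones in }\Sigma_{\mathfrak F_0}\}\hookrightarrow\mathfrak Q_g(\mathbb Z),$$ where $\mathfrak Q_g(\mathbb Z)$ is the set of all integral points of the $g$-KE-characteristic variety $\mathfrak Q_g$.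
   Context: Notation. $V_{\mathbb Z}=\bigoplus_{i=1}^{2g}\mathbb Z e_i$, $V_R=V_{\mathbb Z}\otimes R$; $\psi$ is the symplectic form with $\psi(e_i,e_{g+i})=-1$ ($1\le i\le g$), $\psi(e_i,e_j)=0$ if $|i-j|\ne g$; $\mathrm{Sp}(g,R)$ is the group of automorphisms of $(V_R,\psi)$, $\mathfrak g=\mathrm{Lie}(\mathrm{Sp}(g,\mathbb R))$. $\mathfrak H_g$ is the Siegel space of degree $g$, identified with $\mathfrak S_g=\{F^1\in\mathrm{Grass}(g,V_{\mathbb C}):\psi(F^1,F^1)=0,\ \sqrt{-1}\psi(F^1,\overline{F^1})>0\}$ via $\tau\mapsto$ column span of $\binom{\tau}{I_g}$; $\check{\mathfrak S}_g=\{F^1:\psi(F^1,F^1)=0\}$, and $\overline{\mathfrak S}_g\subset\check{\mathfrak S}_g$ is defined by $\sqrt{-1}\psi(F^1,\overline{F^1})\ge0$. A subgroup $\Gamma\subset\mathrm{Sp}(g,\mathbb Z)$ is arithmetic iff it has finite index; it is neat if for every element the eigenvalues generate a torsion-free subgroup of $\mathbb C^*$. Cusps. For a rationally defined isotropic $W\subset V_{\mathbb R}$, the cusp is $\mathfrak F(W)=\{F^1\in\overline{\mathfrak S}_g:F^1\cap\overline{F^1}=W_{\mathbb C}\}$. $\mathfrak F(W_1)\prec\mathfrak F(W_2)$ iff $W_2\subset W_1$. Minimal cusps are those with $\dim W=g$; the standard minimal cusp is $\mathfrak F_0=\mathfrak F(\mathrm{span}(e_1,\dots,e_g))$. For $\mathfrak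 F=\mathfrak F(W)$: $\mathcal N(\mathfrak F)$ is its stabilizer in $\mathrm{Sp}(g,\mathbb R)$; $u^{\mathfrak F}=\{N\in\mathfrak g:N(V_{\mathbb R})\subset W,N(W^\perp)=0\}$; $U^{\mathfrak F}=\exp(u^{\mathfrak F})=1+u^{\mathfrak F}$, identified with $u^{\mathfrak F}$, with integral structure $U^{\mathfrak F}(\mathbb Z)$; $C(\mathfrak F)=\{N\in u^{\mathfrak F}:\psi(\cdot,N\cdot)>0\text{ on }V_{\mathbb R}/W^\perp\}$. For $\mathfrak F_0$: $u^{\mathfrak F_0}=\mathrm{Sym}_g(\mathbb R)$, $U^{\mathfrak F_0}(\mathbb Z)=\mathrm{Sym}_g(\mathbb Z)$, $C(\mathfrak F_0)$ is the cone of positive definite matrices, and $f\in\mathrm{GL}(g,\mathbb Z)$ acts by $u\mapsto f u\,{}^tf$. $\Gamma_{\mathfrak F}=\Gamma\cap\mathcal N(\mathfrak F)$, and $\overline{\Gamma_{\mathfrak F}}$ is its image in $\mathrm{Aut}(C(\mathfrak F))$ under conjugation. The rational closure $\overline{C(\mathfrak F)}^{\mathrm{rc}}$ is the union of the rational boundary components $(\overline{C(\mathfrak F)}\cap E')^\circ$, $E'$ a rational subspace with $E'\cap C(\mathfrak F)=\emptyset$, together with $C(\mathfrak F)$ itself. Decompositions. For a group $\mathbb G$ acting on $C(\mathfrak F)$, a $\mathbb G$-admissible polyhedral decomposition of $C(\mathfrak F)$ is a (possibly infinite) fan $\Sigma_{\mathfrak F}$ of strongly convex rational polyhedral cones in $\overline{C(\mathfrak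 F)}$ with union $\overline{C(\mathfrak F)}^{\mathrm{rc}}$, stable under $\mathbb G$ with finitely many $\mathbb G$-orbits of cones. It is regular with respect to $\Gamma$ if each cone is generated by part of a $\mathbb Z$-basis of the lattice $\Gamma\cap U^{\mathfrak F}(\mathbb Z)$. $\Sigma_{\mathfrak F_0}$ induces a family $\{\Sigma_{\mathfrak F}\}$ over all cusps: $\Sigma_{M\mathfrak F_0}=\{M\sigma M^{-1}:\sigma\in\Sigma_{\mathfrak F_0}\}$ for $M\in\mathrm{Sp}(g,\mathbb Z)$, and $\Sigma_{\mathfrak F}=\{\sigma\cap\overline{C(\mathfrak F)}:\sigma\in\Sigma_{\mathfrak F_{\min}}\}$ for a minimal cusp $\mathfrak F_{\min}\prec\mathfrak F$. Toroidal compactification (Ash–Mumford–Rapoport–Tai). Let $T_{\mathfrak F}=U^{\mathfrak F}(\mathbb C)/(\Gamma\cap U^{\mathfrak F}(\mathbb Q))$, $X_{\Sigma_{\mathfrak F}}\supset T_{\mathfrak F}$ the torus embedding of the fan, $D(\mathfrak F)=U^{\mathfrak F}(\mathbb C)\cdot\mathfrak S_g\subset\check{\mathfrak S}_g$, and $Z'_{\mathfrak F}$ the interior of the closure of $\mathfrak H_g/(\Gamma\cap U^{\mathfrak F}(\mathbb Q))$ in $X_{\Sigma_{\mathfrak F}}\times_{T_{\mathfrak F}}\big(D(\mathfrak F)/(\Gamma\cap U^{\mathfrak F}(\mathbb Q))\big)$. The toroidal compactification $\overline{\mathcal A}_{g,\Gamma}$ constructed by $\Sigma_{\mathfrak F_0}$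 is the unique compact Hausdorff analytic variety containing $\mathcal A_{g,\Gamma}$ as an open dense subset, with open morphisms $\pi'_{\mathfrak F}:Z'_{\mathfrak F}\to\overline{\mathcal A}_{g,\Gamma}$ extending $\mathfrak H_g/(\Gamma\cap U^{\mathfrak F}(\mathbb Q))\to\mathcal A_{g,\Gamma}$ and whose images cover. The variety $\mathfrak Q_g$. Let $N=g(g+1)/2$. For $1\le i\le N$ let $Y(i)=(y_{kl}(i))$ be a symmetric $g\times g$ matrix of $N$ independent variables, identified with the row $\widetilde Y(i)=(y_{11}(i),\dots,y_{1g}(i),y_{22}(i),\dots,y_{2g}(i),\dots,y_{gg}(i))$; let $Y$ be the $N\times N$ matrix with rows $\widetilde Y(1),\dots,\widetilde Y(N)$ and $D(Y)=\det Y$. Put $F=\det\big(\sum_{i=1}^Nx_iY(i)\big)$, $$\mathcal C=\det\Big(F\tfrac{\partial^2F}{\partial x_i\partial x_j}-\tfrac{\partial F}{\partial x_i}\tfrac{\partial F}{\partial x_j}\Big)_{1\le i,j\le N}-(-1)^{\frac{g(g+1)}2}2^{\frac{g(g-1)}2}F^{(g+1)(g-1)}D(Y)^2,$$ and write $\mathcal C=\sum_{j_1+\dots+j_N=g(g^2-1)}C_{j_1\cdots j_N}(Y)\,x_1^{j_1}\cdots x_N^{j_N}$. Let $\mathfrak A_g=\{Z\in M_{N\times N}(\mathbb C):\det Z\ne0,\ C_{j_1\cdots j_N}(Z)=0\ \text{for all }j_1+\dots+j_N=g(g^2-1),\ j_k\ge0\}$. The symmetric group $S_N$ acts on $\mathfrak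 A_g$ freely by permuting rows, and the $g$-KE-characteristic variety is the quotient $\mathfrak Q_g=\mathfrak A_g/S_N$, an affine variety over $\mathbb Q$. Integral points are understood as classes of matrices with integer entries. The map $\nu_\Gamma$. For a top-dimensional cone $\sigma_{\max}=\sum_{\mu=1}^N\mathbb R_{\ge0}\overrightarrow{l(\mu)}$ with $\{\overrightarrow{l(\mu)}\}$ a $\mathbb Z$-basis of $\Gamma\cap U^{\mathfrak F_0}(\mathbb Z)\subset\mathrm{Sym}_g(\mathbb Z)$, $\nu_\Gamma(\sigma_{\max})$ is the $S_N$-class of the integral $N\times N$ matrix whose $\mu$-th row lists the entries $l^\mu_{1,1},l^\mu_{1,2},\dots,l^\mu_{g-1,g},l^\mu_{g,g}$ on and above the diagonal of $\overrightarrow{l(\mu)}$. *)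

(* Defs.v *)
From HB Require Import structures.
From Stdlib Require Import Relation_Operators.
From mathcomp Require Import all_boot all_order all_fingroup all_algebra.
From mathcomp Require Import complex.
From mathcomp Require mpoly.
From mathcomp Require Import generic_quotient zify.

Set Implicit Arguments.
Unset Strict Implicit.
Unset Printing Implicit Defensive.

Import Order.TTheory GRing.Theory Num.Theory.
Local Open Scope ring_scope.

Definition symdim (g : nat) : nat := ((g * g.+1)./2)%N.

Definition upper_pair (g : nat) : pred ('I_g * 'I_g) := fun p => (p.1 <= p.2)%N.
Arguments upper_pair g : clear implicits.

Lemma card_upper_pair (g : nat) : #|upper_pair g| = symdim g.
Proof.
rewrite -sum1_card big_mkcond /=.
rewrite (eq_bigr (fun p : 'I_g * 'I_g => ((p.1 <= p.2) : nat)%N)); last first.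
  by move=> p _; rewrite /in_mem /= /upper_pair; case: leq.
rewrite -(pair_big xpredT xpredT (fun i j : 'I_g => ((i <= j) : nat)%N)) /=.
rewrite exchange_big /=.
rewrite (eq_bigr (fun j : 'I_g => j.+1)); last first.
  move=> j _; transitivity (\sum_(i < g | (i < j.+1)%N) 1)%N.
    by rewrite [RHS]big_mkcond; apply: eq_bigr => i _; rewrite ltnS; case: leq.
  by rewrite -(big_ord_widen g (fun=> 1%N)) // sum1_card card_ord.
rewrite -(big_mkord xpredT (fun j => j.+1)) /symdim.
elim: g => [|g IH]; first by rewrite big_geq.
by rewrite big_nat_recr //= IH; lia.
Qed.

(* The pairs (k, l) with k <= l, in the lexicographic order of the enumeration
   of a product: (0,0), .., (0,g-1), (1,1), .., (1,g-1), .., (g-1,g-1). *)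
Definition pair_of (g : nat) (j : 'I_(symdim g)) : 'I_g * 'I_g :=
  enum_val (cast_ord (esym (card_upper_pair g)) j).

Definition upper_row (S : Type) (g : nat) (B : 'M[S]_g) : 'rV[S]_(symdim g) :=
  \row_j B (pair_of j).1 (pair_of j).2.

(* For each (k, l) exactly one j contributes to the sum. *)
Definition sym_of_row (S : nzRingType) (g : nat) (r : 'rV[S]_(symdim g)) :
    'M[S]_g :=
  \matrix_(k, l) \sum_(j | pair_of j \in [:: (k, l); (l, k)]) r 0 j.

Module KE.
Import mpoly.

Section KEpolynomial.
Variables (S : comNzRingType) (g : nat) (Y : 'M[S]_(symdim g)).
Local Notation N := (symdim g).

Definition detF : {mpoly S[N]} :=
  \det (\sum_(i < N) 'X_i *: map_mx (mpolyC N (R := S)) (sym_of_row (row i Y))).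

Definition KEpoly : {mpoly S[N]} :=
  \det (\matrix_(i < N, j < N)
          (detF * detF^`M(j)^`M(i) - detF^`M(i) * detF^`M(j)))
  - (-1) ^+ symdim g * 2%:R ^+ ((g * g.-1)./2) * detF ^+ (g.+1 * g.-1)
    * (mpolyC N (\det Y)) ^+ 2.
End KEpolynomial.

Section KEvariety.
Variables (F : fieldType) (g : nat).
Local Notation N := (symdim g).

Definition genericY : 'M[{mpoly int[N * N]}]_N :=
  \matrix_(i, j) 'X_(mxvec_index i j).

Definition KEcoef (m : 'X_{1..N}) : {mpoly int[N * N]} := (KEpoly genericY)@_m.

Definition KEcoef_at (m : 'X_{1..N}) (Z : 'M[F]_N) : F :=
  mmap intr (mxvec Z 0) (KEcoef m).

Definition Ag (Z : 'M[F]_N) : Prop :=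
  \det Z != 0 /\
  forall m : 'X_{1..N}, mdeg m = (g * (g ^ 2 - 1))%N -> KEcoef_at m Z = 0.
End KEvariety.
End KE.

From mathcomp Require Import all_classical all_reals all_analysis.
Import numFieldNormedType.Exports.
Local Open Scope classical_set_scope.
Local Open Scope complex_scope.

HB.instance Definition _ (R : realType) := NormedModule.copy R[i] R[i]^o.

Section KEquotient.
Variables (F : fieldType) (g : nat).
Local Notation N := (symdim g).

Definition row_class (Z : 'M[F]_N) : set 'M[F]_N :=
  [set row_perm s Z | s in [set: 'S_N]].

Definition Qg : set (set 'M[F]_N) :=
  [set row_class Z | Z in [set Z | KE.Ag Z]].

Definition Qg_int : set (set 'M[F]_N) :=
  Qg `&` [set row_class (map_mx intr Z) | Z in [set: 'M[int]_N]].
End KEquotient.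

(* A topological space with a sheaf of complex-valued functions: [hol x f]
   means that [f] is holomorphic on a neighbourhood of [x]. *)
Record aspace (R : realType) := ASpace {
  acarrier :> topologicalType ;
  hol : acarrier -> set (acarrier -> R[i])
}.
Arguments hol {R a}.

Section AnalyticSpaces.
Variable R : realType.
Local Notation C := R[i].

Definition holfun (m n : nat) (U : set 'M[C]_(m, n)) (f : 'M[C]_(m, n) -> C) :=
  forall z, U z -> differentiable f z.

Definition hol_near (m n : nat) (z : 'M[C]_(m, n)) (f : 'M[C]_(m, n) -> C) :=
  \forall z' \near z, differentiable f z'.

Definition amatrix (m n : nat) : aspace R :=
  @ASpace R 'M[C]_(m, n) (@hol_near m n).

(* C^I, with I possibly infinite: functions depending locally and
   holomorphically on finitely many coordinates. *)
Definition afun (I : Type) : aspace R :=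
  @ASpace R {ptws I -> C} (fun x f =>
    exists (n : nat) (a : 'I_n -> I) (h : 'rV[C]_n -> C),
      hol_near (\row_k x (a k)) h /\
      \forall y \near (x : {ptws I -> C}), f y = h (\row_k y (a k))).

Definition asub (X : aspace R) (A : set X) : aspace R :=
  @ASpace R (set_type A) (fun x f =>
    exists h : X -> C, hol (\val x) h /\ \forall y \near x, f y = h (\val y)).

Definition aprod (X Y : aspace R) : aspace R :=
  @ASpace R (X * Y)%type (fun p f =>
    exists (m n : nat) (a : 'I_m -> X -> C) (b : 'I_n -> Y -> C)
           (h : 'rV[C]_(m + n) -> C),
      let coords (q : X * Y) := row_mx (\row_k a k q.1) (\row_k b k q.2) in
      [/\ forall k, hol p.1 (a k), forall k, hol p.2 (b k),
          hol_near (coords p) h & \forall q \near p, f q = h (coords q)]).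

Definition asum (I : choiceType) (X : I -> aspace R) : aspace R :=
  @ASpace R {i : I & X i} (fun p f =>
    hol (projT2 p) (fun y => f (existT X (projT1 p) y))).

Section Quotient.
Variables (X : aspace R) (r : X -> X -> Prop).

Definition qrel : rel X := fun x y => `[< clos_refl_sym_trans X r x y >].

Lemma qrel_refl : reflexive qrel.
Proof. by move=> x; apply/asboolP; exact: rst_refl. Qed.

Lemma qrel_sym : symmetric qrel.
Proof. by move=> x y; apply/asboolP/asboolP; exact: rst_sym. Qed.

Lemma qrel_trans : transitive qrel.
Proof.
by move=> y x z /asboolP xy /asboolP yz; apply/asboolP; exact: rst_trans xy yz.
Qed.

Definition qequiv := EquivRel qrel qrel_refl qrel_sym qrel_trans.

(* Quotient by the equivalence relation generated by [r]. *)
Definition aquot_top : topologicalType := quotient_topology {eq_quot qequiv}%qT.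

Definition acls (x : X) : aquot_top := (\pi_({eq_quot qequiv}%qT) x)%qT.

Definition aquot : aspace R :=
  @ASpace R aquot_top (fun q f =>
    \forall q' \near q, forall x, acls x = q' -> hol x (f \o acls)).
End Quotient.

Definition amorphism (X Y : aspace R) (f : X -> Y) : Prop :=
  continuous f /\ forall x h, hol (f x) h -> hol x (h \o f).

Definition open_map (X Y : topologicalType) (f : X -> Y) : Prop :=
  forall U : set X, open U -> open (f @` U).

Definition aopen_immersion (X Y : aspace R) (f : X -> Y) : Prop :=
  [/\ injective f, continuous f, open_map f
    & forall x h, hol (f x) h <-> hol x (h \o f)].

(* [phi] identifies the open subspace [U] of [X] with the locally closed
   [V] of C^n carrying the restrictions of holomorphic functions. *)
Definition achart (X : aspace R) (n : nat) (U : set X) (phi : X -> 'rV[C]_n)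
    (V : set 'rV[C]_n) : Prop :=
  [/\ open U, phi @` U = V, set_inj U phi,
      forall x, U x -> forall B : set X,
        nbhs x B <-> exists2 B', nbhs (phi x) B' & U `&` phi @^-1` B' `<=` B
    & forall x, U x -> forall f : X -> C,
        hol x f <-> exists2 h, hol_near (phi x) h &
                      \forall y \near x, f y = h (phi y)].

Definition analytic_subset (n : nat) (V : set 'rV[C]_n) : Prop :=
  exists (O : set 'rV[C]_n) (k : nat) (e : 'I_k -> 'rV[C]_n -> C),
    [/\ open O, forall i, holfun O (e i)
      & V = O `&` [set z | forall i, e i z = 0]].

Definition analytic_variety (X : aspace R) : Prop :=
  forall x : X, exists (n : nat) (U : set X) (phi : X -> 'rV[C]_n) V,
    [/\ U x, analytic_subset V & achart U phi V].

(* D is the union of finitely many smooth connected hypersurfaces (its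
   irreducible components) of the complex manifold X; near every point those
   passing through it are distinct coordinate hyperplanes of a chart. *)
Definition simple_normal_crossing (X : aspace R) (D : set X) : Prop :=
  exists (m : nat) (E : 'I_m -> set X),
    [/\ forall k, closed (E k), forall k, connected (E k),
        D = \bigcup_k E k
      & forall x : X, exists (n : nat) (U : set X) (phi : X -> 'rV[C]_n) V
          (c : 'I_m -> 'I_n),
        [/\ U x, open V, achart U phi V,
            set_inj [set k | E k x] c
          & forall k, [/\ E k x -> U `&` E k = U `&` [set y | phi y 0 (c k) = 0]
                        & ~ E k x -> U `&` E k = set0]]].

End AnalyticSpaces.

Section Symplectic.
Variable g : nat.

Definition Jmx (K : nzRingType) : 'M[K]_(g + g) := block_mx 0 (- 1%:M) 1%:M 0.

Definition psi (K : nzRingType) (u v : 'cV[K]_(g + g)) : K :=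
  (u^T *m Jmx K *m v) 0 0.

Definition Sp (K : nzRingType) : set 'M[K]_(g + g) :=
  [set M | M^T *m Jmx K *m M = Jmx K].
Arguments Sp : clear implicits.

Definition mxact (K : fieldType) (M : 'M[K]_(g + g))
    (W : {vspace 'cV[K]_(g + g)}) : {vspace 'cV[K]_(g + g)} :=
  (linfun (mulmx M) @: W)%VS.

Definition isotropic (K : fieldType) (W : {vspace 'cV[K]_(g + g)}) : Prop :=
  {in W &, forall u v, psi u v = 0}.

Definition perp (K : fieldType) (W : {vspace 'cV[K]_(g + g)}) :
    set 'cV[K]_(g + g) :=
  [set v | {in W, forall w, psi w v = 0}].

Definition uF (K : fieldType) (W : {vspace 'cV[K]_(g + g)}) :
    set 'M[K]_(g + g) :=
  [set N | [/\ N^T *m Jmx K + Jmx K *m N = 0, forall v, N *m v \in W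
             & forall v, perp W v -> N *m v = 0]].

Definition arithmetic_subgroup (Gamma : set 'M[int]_(g + g)) : Prop :=
  [/\ Gamma `<=` Sp int,
      [/\ Gamma 1%:M, forall M N, Gamma M -> Gamma N -> Gamma (M *m N)
        & forall M, Gamma M -> Gamma (invmx M)]
    & exists s : seq 'M[int]_(g + g), forall M, Sp int M ->
        exists2 N, N \in s & exists2 G, Gamma G & M = G *m N].

Definition mulgroup_gen (K : fieldType) (S : set K) : set K :=
  smallest [set H : set K | [/\ H 1, forall x y, H x -> H y -> H (x * y)
                              & forall x, H x -> H x^-1]] S.

Definition neat (R : realType) (Gamma : set 'M[int]_(g + g)) : Prop :=
  forall G, Gamma G -> forall z : R[i],
    mulgroup_gen [set x : R[i] | root (char_poly (map_mx intr G)) x] z ->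
    forall n : nat, (0 < n)%N -> z ^+ n = 1 -> z = 1.

Section Siegel.
Variable R : realType.
Local Notation C := R[i].
Local Notation VR := {vspace 'cV[R]_(g + g)}.
Local Notation VC := {vspace 'cV[C]_(g + g)}.

Definition mxC (m n : nat) (A : 'M[R]_(m, n)) : 'M[C]_(m, n) :=
  map_mx (real_complex R) A.
Definition intC (m n : nat) (A : 'M[int]_(m, n)) : 'M[C]_(m, n) := map_mx intr A.
Definition intR (m n : nat) (A : 'M[int]_(m, n)) : 'M[R]_(m, n) := map_mx intr A.
Definition ratR (m n : nat) (A : 'M[rat]_(m, n)) : 'M[R]_(m, n) := map_mx ratr A.
Definition conjv (m n : nat) (v : 'M[C]_(m, n)) : 'M[C]_(m, n) :=
  map_mx Num.conj v.

Definition complexify (W : VR) : VC := <<[seq mxC w | w <- vbasis W]>>%VS.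

(* The isotropic part of Grass(g, V_C), as full-rank (2g x g)-frames modulo
   equality of column spans. *)
Definition lagr_frame : aspace R :=
  asub (X := amatrix R (g + g) g)
    [set A : 'M[C]_(g + g, g) | \rank A = g /\ A^T *m Jmx C *m A = 0].

Definition colspan (A : lagr_frame) : VC :=
  <<[seq col j (\val A) | j <- enum 'I_g]>>%VS.

Definition Scheck : aspace R := aquot (fun A B : lagr_frame => colspan A = colspan B).

Definition F1space (F : Scheck) : VC := colspan (repr F).

Definition Siegel : set Scheck :=
  [set F | forall v, v \in F1space F -> v != 0 -> 0 < 'i * psi v (conjv v)].

Definition Siegel_bar : set Scheck :=
  [set F | forall v, v \in F1space F -> 0 <= 'i * psi v (conjv v)].

Definition rational_isotropic (W : VR) : Prop :=
  isotropic W /\ exists s : seq 'cV[rat]_(g + g), W = <<[seq ratR v | v <- s]>>%VS.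

Definition minimal_cusp (W : VR) : Prop := rational_isotropic W /\ \dim W = g.

Definition W0 : VR := <<[seq delta_mx (lshift g i) 0%R | i <- enum 'I_g]>>%VS.

Definition cusp (W : VR) : set Scheck :=
  [set F | Siegel_bar F /\
           forall v, (v \in F1space F) && (conjv v \in F1space F)
                     = (v \in complexify W)].

Definition Nstab (W : VR) : set 'M[R]_(g + g) :=
  [set M | Sp R M /\
     [set F' | exists2 F, cusp W F & F1space F' = mxact (mxC M) (F1space F)]
     = cusp W].

Definition cone_F (W : VR) : set 'M[R]_(g + g) :=
  [set N | uF W N /\ forall v, ~ perp W v -> 0 < psi v (N *m v)].

Definition cone_gen (I : finType) (v : I -> 'M[R]_(g + g)) : set 'M[R]_(g + g) :=
  [set x | exists2 c : I -> R, forall i, 0 <= c i & x = \sum_i c i *: v i].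

Definition rational_cone (s : set 'M[R]_(g + g)) : Prop :=
  exists (n : nat) (v : 'I_n -> 'M[rat]_(g + g)), s = cone_gen (fun k => ratR (v k)).

Definition strongly_convex (s : set 'M[R]_(g + g)) : Prop :=
  forall x, s x -> s (- x) -> x = 0.

Definition face (t s : set 'M[R]_(g + g)) : Prop :=
  exists2 l : {scalar 'M[R]_(g + g)},
    forall x, s x -> 0 <= l x & t = s `&` [set x | l x = 0].

Definition fan (S : set (set 'M[R]_(g + g))) : Prop :=
  [/\ forall s, S s -> rational_cone s /\ strongly_convex s,
      forall s t, S s -> face t s -> S t
    & forall s t, S s -> S t -> face (s `&` t) s /\ face (s `&` t) t].

Definition rational_subspace (W : VR) (E : {vspace 'M[R]_(g + g)}) : Prop :=
  (exists s : seq 'M[rat]_(g + g), E = <<[seq ratR v | v <- s]>>%VS) /\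
  (forall x, x \in E -> uF W x).

(* The interior is taken relatively to E'. *)
Definition rational_closure (W : VR) : set 'M[R]_(g + g) :=
  cone_F W `|`
  [set x | exists E' : {vspace 'M[R]_(g + g)},
     [/\ rational_subspace W E', [set` E'] `&` cone_F W = set0, x \in E'
       & \forall y \near x, y \in E' -> closure (cone_F W) y]].

Definition admissible (W : VR) (G : set ('M[R]_(g + g) -> 'M[R]_(g + g)))
    (S : set (set 'M[R]_(g + g))) : Prop :=
  [/\ fan S, \bigcup_(s in S) s = rational_closure W,
      forall a s, G a -> S s -> S (a @` s)
    & exists2 T : set (set 'M[R]_(g + g)), finite_set T /\ T `<=` S &
        forall s, S s -> exists2 t, T t & exists2 a, G a & s = a @` t].

Definition mxconj (M N : 'M[R]_(g + g)) : 'M[R]_(g + g) := M *m N *m invmx M.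

Variable Gamma : set 'M[int]_(g + g).

Definition GammaF_bar (W : VR) : set ('M[R]_(g + g) -> 'M[R]_(g + g)) :=
  [set mxconj (intR G) | G in Gamma `&` [set G | Nstab W (intR G)]].

(* f in GL(g, Z), acting on the upper right block B by B |-> f B f^T. *)
Definition GLgZ_act : set ('M[R]_(g + g) -> 'M[R]_(g + g)) :=
  [set mxconj (intR (block_mx f 0 0 (invmx f)^T)) |
     f in [set f : 'M[int]_g | f \in unitmx]].

(* Gamma /\ U^F(Z), where U^F = 1 + u^F is identified with u^F. *)
Definition ulattice (W : VR) : set 'M[int]_(g + g) :=
  [set n | uF W (intR n) /\ Gamma (1%:M + n)].

Definition lattice_basis (W : VR) (n : nat) (l : 'I_n -> 'M[int]_(g + g)) : Prop :=
  (forall k, ulattice W (l k)) /\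
  forall x, ulattice W x ->
    exists! c : {ffun 'I_n -> int}, x = \sum_k l k *~ c k.

Definition regular_decomposition (W : VR) (S : set (set 'M[R]_(g + g))) : Prop :=
  forall s, S s -> exists (n : nat) (l : 'I_n -> 'M[int]_(g + g)) (I : {set 'I_n}),
    lattice_basis W l /\ s = cone_gen (fun k : {k | k \in I} => intR (l (val k))).

Definition cone_dim (s : set 'M[R]_(g + g)) (n : nat) : Prop :=
  exists2 E : {vspace 'M[R]_(g + g)}, \dim E = n &
    (s `<=` [set` E]) /\
    forall E' : {vspace 'M[R]_(g + g)}, s `<=` [set` E'] -> (E <= E')%VS.

Definition top_cones (S : set (set 'M[R]_(g + g))) : set (set 'M[R]_(g + g)) :=
  [set s | S s /\ cone_dim s (symdim g)].

(* [fam W] is the decomposition attached to the cusp F(W).  When S0 is stable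
   under GL(g, Z) the transported decomposition at a minimal cusp does not depend
   on M; when S0 is only stable under Gamma_F0, one M is chosen for each minimal
   cusp, compatibly with the action of Gamma and between minimal cusps. *)
Definition induced_family (S0 : set (set 'M[R]_(g + g)))
    (fam : VR -> set (set 'M[R]_(g + g))) : Prop :=
  [/\ fam W0 = S0,
      forall W, minimal_cusp W -> exists2 M : 'M[int]_(g + g), Sp int M &
        W = mxact (intR M) W0 /\ fam W = [set mxconj (intR M) @` s | s in S0],
      forall W G, minimal_cusp W -> Gamma G ->
        fam (mxact (intR G) W) = [set mxconj (intR G) @` s | s in fam W]
    & forall W Wmin, rational_isotropic W -> minimal_cusp Wmin -> (W <= Wmin)%VS ->
        fam W = [set s `&` closure (cone_F W) | s in fam Wmin]].

(* The trace form is positive definite on u^F, and is used to identify the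
   character group of T_F with a lattice in u^F. *)
Definition character_lattice (W : VR) : set 'M[R]_(g + g) :=
  [set A | uF W A /\
     forall n, ulattice W n -> exists k : int, \tr (A^T *m intR n) = k%:~R].

Definition dual_semigroup (W : VR) (s : set 'M[R]_(g + g)) : set 'M[R]_(g + g) :=
  [set A | character_lattice W A /\ forall x, s x -> 0 <= \tr (A^T *m x)].

(* Semigroup homomorphisms from the dual semigroup to (C, * ), extended by 0. *)
Definition affine_toric (W : VR) (s : set 'M[R]_(g + g)) : aspace R :=
  asub (X := afun R 'M[R]_(g + g))
    [set x : 'M[R]_(g + g) -> C |
      [/\ x 0 = 1,
          forall A B, dual_semigroup W s A -> dual_semigroup W s B ->
            x (A + B) = x A * x B
        & forall A, ~ dual_semigroup W s A -> x A = 0]].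

Section TorusEmbedding.
Variables (W : VR) (S : set (set 'M[R]_(g + g))).

Definition toric_charts : aspace R :=
  asum (fun s : set_type S => affine_toric W (\val s)).

(* Gluing along the open inclusions X_t -> X_s, t a face of s. *)
Definition toric_glue (p q : toric_charts) : Prop :=
  face (\val (projT1 q)) (\val (projT1 p)) /\
  forall A, dual_semigroup W (\val (projT1 p)) A ->
    \val (projT2 p) A = \val (projT2 q) A.

Definition torus_embedding : aspace R := aquot toric_glue.

(* exp (2 i pi z) *)
Definition e2pi (z : C) : C :=
  (expR (- (2 * pi * complex.Im z)))%:C
  * (cos (2 * pi * complex.Re z) +i* sin (2 * pi * complex.Re z)).

(* q is the translate of p by the class in T_F of u in U^F(C). *)
Definition torus_translate (u : 'M[C]_(g + g)) (p q : torus_embedding) : Prop :=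
  exists (s : set_type S) (x y : affine_toric W (\val s)),
    [/\ p = acls toric_glue (existT _ s x), q = acls toric_glue (existT _ s y)
      & forall A, \val y A = e2pi (\tr ((mxC A)^T *m u)) * \val x A].

Definition torus_unit (p : torus_embedding) : Prop :=
  exists (s : set_type S) (x : affine_toric W (\val s)),
    p = acls toric_glue (existT _ s x) /\
    forall A, dual_semigroup W (\val s) A -> \val x A = 1.

Definition DF_set : set Scheck :=
  [set F | exists2 F', Siegel F' & exists2 u, uF (complexify W) u &
           F1space F = mxact (1%:M + u) (F1space F')].

Definition DF : aspace R := asub DF_set.

(* (p, d) is identified with (u p, (1 + u)^-1 d) for u in u^F(C); for u in the
   lattice this is the quotient of D(F) by Gamma /\ U^F(Q). *)
Definition contracted_rel (a b : aprod torus_embedding DF) : Prop :=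
  exists2 u, uF (complexify W) u &
    torus_translate u a.1 b.1 /\
    F1space (\val a.2) = mxact (1%:M + u) (F1space (\val b.2)).

Definition contracted_product : aspace R := aquot contracted_rel.

(* [z] is the image of the point [F] of the Siegel space. *)
Definition from_Siegel (F : Scheck) (z : contracted_product) : Prop :=
  Siegel F /\ exists (p : torus_embedding) (d : DF),
    [/\ torus_unit p, \val d = F & z = acls contracted_rel (p, d)].

Definition Zprime : aspace R :=
  asub (interior (closure [set z | exists F, from_Siegel F z])).
End TorusEmbedding.

Definition Siegel_space : aspace R := asub Siegel.

Definition same_orbit (F F' : Siegel_space) : Prop :=
  exists2 G, Gamma G & F1space (\val F') = mxact (intC G) (F1space (\val F)).

Definition AgGamma : aspace R := aquot same_orbit.

Definition toroidal_compactification (S0 : set (set 'M[R]_(g + g)))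
    (Abar : aspace R) (j : AgGamma -> Abar) : Prop :=
  [/\ compact [set: Abar], hausdorff_space Abar, analytic_variety Abar,
      aopen_immersion j /\ dense (range j)
    & exists2 fam, induced_family S0 fam &
      exists piF : forall W : VR, Zprime W (fam W) -> Abar,
        (forall W, rational_isotropic W ->
           [/\ amorphism (@piF W), open_map (@piF W)
             & forall (F : Siegel_space) z, from_Siegel (\val F) (\val z) ->
                 piF W z = j (acls same_orbit F)]) /\
        (forall x, exists2 W, rational_isotropic W & exists z, piF W z = x)].

Definition row_matrix (l : 'I_(symdim g) -> 'M[int]_(g + g)) : 'M[int]_(symdim g) :=
  \matrix_(mu < symdim g) upper_row (ursubmx (l mu)).

Definition nu_value (s : set 'M[R]_(g + g)) (q : set 'M[C]_(symdim g)) : Prop :=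
  exists l : 'I_(symdim g) -> 'M[int]_(g + g),
    [/\ lattice_basis W0 l, s = cone_gen (fun k => intR (l k))
      & q = row_class (intC (row_matrix l))].

End Siegel.
End Symplectic.

Arguments W0 g R : clear implicits.
Arguments GLgZ_act g R : clear implicits.
Arguments Qg_int F g : clear implicits.

(* Main.v *)
Require Import Defs.
From HB Require Import structures.
From mathcomp Require Import all_boot all_order all_fingroup all_algebra complex.
From mathcomp Require mpoly.
From mathcomp Require Import zify ring.

(** Write [X = \sum_i x_i Y(i)], [F = \det X] and [P = \adj X].  The polynomial
    defining the characteristic variety vanishes identically.  Indeed
    [F F_ij - F_i F_j] is [F ^+ 2] times the Hessian of [log F], and
    differentiating [X P = F] turns it into [- \tr (P Y(i) P Y(j))]
    ([hessian_log_det]): up to sign, the Gram matrix, in the family [Y(i)], of the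
    quadratic form [\tr (P A P A)] on symmetric matrices.  Its determinant
    ([det_gram]) is the product of

    - [\det Y ^+ 2], from the change of basis;
    - [\det P ^+ g.+1], the determinant of the action [A |-> P^T A P] of [P] on
      symmetric matrices ([det_congr]);
    - [2 ^+ (g (g - 1) / 2)], since an entry above the diagonal is counted twice
      in [\tr (A A)].

    As [\det P = F ^+ g.-1], this is the subtracted term ([KEpoly_eq0]).  Hence
    membership in the variety is just the invertibility of the matrix
    ([Ag_of_det_neq0]).

    What remains is lattice geometry.  The Lie algebra attached to the standard
    minimal cusp is the space of symmetric matrices ([uF_W0P]), of dimension
    [N = g (g + 1) / 2].  A top-dimensional cone of a regular decomposition is
    therefore generated by a full integral basis ([top_cone_basis]), whose
    coordinate matrix has nonzero determinant ([det_coord_mx]).  Two bases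
    generating the same cone are related by mutually inverse matrices of
    non-negative integers, which are permutation matrices
    ([nonneg_inverse_perm]), so the class modulo row permutations depends only on
    the cone ([nu_value_uniq]).  Conversely the class determines the set of
    generators, hence the cone ([nu_value_inj]). *)

Set Implicit Arguments.
Unset Strict Implicit.
Unset Printing Implicit Defensive.

Import Order.TTheory GRing.Theory Num.Theory.
Local Open Scope ring_scope.

(** * Products of triangular matrices *)

Inductive trig_product (R : comNzRingType) n : 'M[R]_n -> Prop :=
| TrigLower A : is_trig_mx A -> trig_product A
| TrigUpper A : is_trig_mx A^T -> trig_product A
| TrigMul A B : trig_product A -> trig_product B -> trig_product (A *m B).

Lemma trig_product_block (R : comNzRingType) n (A : 'M[R]_n) :
  trig_product A -> trig_product (block_mx (1%:M : 'M_1) 0 0 A).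
Proof.
elim=> [{}A tA|{}A tA|{}A B _ IHA _ IHB].
- by apply: TrigLower; rewrite is_trig_block_mx //= eqxx scalar_mx_is_trig.
- apply: TrigUpper; rewrite tr_block_mx !trmx0 tr_scalar_mx.
  by rewrite is_trig_block_mx //= eqxx scalar_mx_is_trig.
- have -> : block_mx 1%:M 0 0 (A *m B) =
    block_mx (1%:M : 'M_1) 0 0 A *m block_mx (1%:M : 'M_1) 0 0 B.
    by rewrite mulmx_block !mulmx0 !mul0mx !addr0 add0r mulmx1.
  exact: TrigMul.
Qed.

(** Block elimination of the first row and column; a vanishing pivot is first
    repaired by adding another row to the first one, which is itself a triangular
    operation.  No permutation matrix is needed, so multiplicative identities
    between determinants can be checked on triangular matrices alone. *)
Lemma field_trig_product (F : fieldType) n (A : 'M[F]_n) : trig_product A.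
Proof.
elim: n A => [|n IHn] A.
  by apply: TrigLower; apply/is_trig_mxP => -[].
rewrite -[n.+1]/(1 + n)%N in A *.
(* Elimination with a nonzero pivot, through the Schur complement. *)
have pivot (B : 'M[F]_(1 + n)) : B 0 0 != 0 -> trig_product B.
  move=> B0; have Bul : ulsubmx B = (B 0 0)%:M.
    apply/matrixP => i j; rewrite !mxE !ord1 eqxx mulr1n.
    by congr (B _ _); apply/val_inj.
  pose v := (B 0 0)^-1 *: dlsubmx B.
  have -> : B = block_mx 1%:M 0 v 1%:M *m
     (block_mx 1%:M 0 0 (drsubmx B - v *m ursubmx B) *m
      block_mx (B 0 0)%:M (ursubmx B) 0 1%:M).
    rewrite !mulmx_block !mulmx0 !mul0mx !mul1mx !addr0 !add0r !mulmx1.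
    rewrite mul_mx_scalar scalerA divff // scale1r addrC subrK.
    by rewrite -Bul submxK.
  apply: TrigMul; last apply: TrigMul; last first.
  - apply: TrigUpper; rewrite tr_block_mx trmx0 !tr_scalar_mx.
    by rewrite is_trig_block_mx //= eqxx !scalar_mx_is_trig.
  - exact: trig_product_block.
  - by apply: TrigLower; rewrite is_trig_block_mx //= eqxx !scalar_mx_is_trig.
have [|A0] := eqVneq (A 0 0) 0; last exact: pivot.
move=> A00; have [/forallP /= v0|] := boolP [forall i, A i 0 == 0].
  have -> : A = block_mx (1%:M : 'M_1) 0 0 (drsubmx A) *m
       block_mx (0 : 'M_1) (ursubmx A) 0 1%:M.
    rewrite mulmx_block !mulmx0 !mul0mx !mul1mx !addr0 !add0r !mulmx1.
    rewrite -[LHS]submxK; congr block_mx.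
      apply/matrixP => i j; rewrite !mxE !ord1 -[RHS]A00.
      by congr (A _ _); apply/val_inj.
    apply/matrixP => i j; rewrite !mxE !ord1 -[RHS](eqP (v0 (rshift 1 i))).
    by congr (A _ _); apply/val_inj.
  apply: TrigMul; first exact: trig_product_block.
  apply: TrigUpper; rewrite tr_block_mx !trmx0 !tr_scalar_mx.
  rewrite is_trig_block_mx //= eqxx scalar_mx_is_trig andbT.
  by apply/is_trig_mxP=> i j _; rewrite !mxE.
rewrite negb_forall => /existsP [i Ai].
have i0 : i != 0 by apply: contra Ai => /eqP->; rewrite A00.
have -> : A = (1%:M - delta_mx 0 i) *m ((1%:M + delta_mx 0 i) *m A).
  rewrite mulmxA mulmxBl mul1mx mulmxDr mulmx1 mul_delta_mx_0 // addr0.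
  by rewrite addrK mul1mx.
apply: TrigMul.
  apply: TrigUpper; apply/is_trig_mxP => a b ab; rewrite !mxE.
  have -> : (b == a) = false by apply/negbTE; rewrite -val_eqE gtn_eqF.
  have -> : (b == 0) = false.
    by apply/negbTE; rewrite -val_eqE /= -lt0n (leq_trans _ ab).
  by rewrite subr0.
apply: pivot; rewrite mulmxDl mul1mx mxE A00 add0r mxE (bigD1 i) //= big1 => [|k ki].
  by rewrite mxE !eqxx mul1r addr0.
by rewrite mxE (negPf ki) andbF mul0r.
Qed.

(** Triangularity with respect to a weight on the indices: a permutation along
    nonzero entries never decreases the weight, and it preserves the total
    weight, so it is the identity.  This form dispenses with any explicit total
    order on the indices. *)
Lemma det_graded_triangular (R : comNzRingType) n (M : 'M[R]_n) (w : 'I_n -> nat) :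
  (forall a b, M a b != 0 -> (w a <= w b)%N /\ (w a = w b -> a = b)) ->
  \det M = \prod_a M a a.
Proof.
move=> Mw; rewrite /determinant (bigD1 1%g) //= [X in _ + X]big1 ?addr0 => [|s s1].
  by rewrite odd_perm1 expr0 mul1r; apply: eq_bigr => i _; rewrite perm1.
have [/forallP /= nz|] := boolP [forall a, M a (s a) != 0]; last first.
  rewrite negb_forall => /existsP[a]; rewrite negbK => /eqP Ma0.
  by rewrite (bigD1 a) //= Ma0 mul0r mulr0.
case/eqP: s1; apply/permP => a; rewrite perm1; symmetry.
have [_ wE] := Mw _ _ (nz a); apply: wE; apply/eqP.
have : (\sum_a w a == \sum_a w (s a))%N.
  by rewrite [X in X == _](reindex_inj (@perm_inj _ s)).
have le b : (w b <= w (s b) ?= iff (w b == w (s b)))%N.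
  by split=> //; have [] := Mw _ _ (nz b).
by rewrite (leqif_sum (P := predT) (fun b _ => le b)) => /forallP /(_ a).
Qed.

(** * Coordinates on symmetric matrices *)

Section PairIndex.
Variable g : nat.

Lemma pair_of_le (a : 'I_(symdim g)) : ((pair_of a).1 <= (pair_of a).2)%N.
Proof. exact: (enum_valP (cast_ord (esym (card_upper_pair g)) a)). Qed.

Lemma pair_of_inj : injective (@pair_of g).
Proof. by move=> a b /enum_val_inj /cast_ord_inj. Qed.

Lemma pair_of_surj (p : 'I_g * 'I_g) : (p.1 <= p.2)%N -> exists a, pair_of a = p.
Proof.
move=> le_p; have p_up : p \in upper_pair g by [].
exists (cast_ord (card_upper_pair g) (enum_rank_in p_up p)).
by rewrite /pair_of cast_ordK enum_rankK_in.
Qed.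

Lemma big_pair_of (T : Type) (idx : T) (op : Monoid.com_law idx)
    (f : 'I_g * 'I_g -> T) :
  \big[op/idx]_a f (pair_of a) = \big[op/idx]_(p : 'I_g * 'I_g | (p.1 <= p.2)%N) f p.
Proof.
transitivity (\big[op/idx]_(p in upper_pair g) f p); last by apply: eq_bigl.
rewrite [RHS]big_enum_val [RHS](reindex (cast_ord (esym (card_upper_pair g)))) //=.
by exists (cast_ord (card_upper_pair g)) => ? _; rewrite ?cast_ordK ?cast_ordKV.
Qed.

Section Coordinates.
Variable R : nzRingType.
Implicit Types (r : 'rV[R]_(symdim g)) (B : 'M[R]_g).

Lemma upper_row_linear : linear (@upper_row R g).
Proof. by move=> c A B; apply/rowP => a; rewrite !mxE. Qed.

HB.instance Definition _ := GRing.isLinear.Build R 'M[R]_g 'rV[R]_(symdim g)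
  _ (@upper_row R g) upper_row_linear.

Lemma sym_of_row_linear : linear (@sym_of_row R g).
Proof.
move=> c r s; apply/matrixP => k l; rewrite !mxE mulr_sumr -big_split /=.
by apply: eq_bigr => a _; rewrite !mxE.
Qed.

HB.instance Definition _ := GRing.isLinear.Build R 'rV[R]_(symdim g) 'M[R]_g
  _ (@sym_of_row R g) sym_of_row_linear.

Lemma sym_of_row_pair r a : sym_of_row r (pair_of a).1 (pair_of a).2 = r 0 a.
Proof.
rewrite mxE (big_pred1 a) // => b; rewrite /= !inE -surjective_pairing.
rewrite (inj_eq pair_of_inj); case: eqP => //= ab; apply/negbTE.
apply/eqP => ba; apply: ab; apply: pair_of_inj.
have := pair_of_le a; have := pair_of_le b; rewrite [pair_of b]ba /=.
move=> le1 le2; have e : (pair_of a).1 = (pair_of a).2.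
  by apply/val_inj/eqP; rewrite eqn_leq le1 le2.
by move: e; case: (pair_of a) => x y /= ->.
Qed.

Lemma tr_sym_of_row r : (sym_of_row r)^T = sym_of_row r.
Proof.
apply/matrixP => k l; rewrite !mxE; apply: eq_bigl => a.
by rewrite !inE orbC.
Qed.

Lemma sym_of_rowK : cancel (@sym_of_row R g) (@upper_row R g).
Proof. by move=> r; apply/rowP => a; rewrite mxE sym_of_row_pair. Qed.

Lemma sym_mx_eq B C : B^T = B -> C^T = C ->
  (forall a, B (pair_of a).1 (pair_of a).2 = C (pair_of a).1 (pair_of a).2) ->
  B = C.
Proof.
move=> Bs Cs BC; apply/matrixP => k l.
wlog kl : k l / (k <= l)%N => [W|].
  have [/W //|/ltnW /W lk] := leqP k l.
  by rewrite -Bs -Cs !mxE.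
by have [a aE] := @pair_of_surj (k, l) kl; have := BC a; rewrite aE.
Qed.

Lemma upper_rowK B : B^T = B -> sym_of_row (upper_row B) = B.
Proof.
move=> Bs; apply: sym_mx_eq => // [|a]; first exact: tr_sym_of_row.
by rewrite sym_of_row_pair mxE.
Qed.

End Coordinates.

Lemma map_sym_of_row (R S : nzRingType) (f : {rmorphism R -> S})
    (r : 'rV[R]_(symdim g)) :
  map_mx f (sym_of_row r) = sym_of_row (map_mx f r).
Proof.
apply/matrixP => k l; rewrite !mxE rmorph_sum.
by apply: eq_bigr => a _; rewrite mxE.
Qed.

End PairIndex.

(** * The determinant of the congruence action on symmetric matrices *)

Section Congruence.
Variable g : nat.

Definition congr_row (R : comNzRingType) (P : 'M[R]_g) (r : 'rV_(symdim g)) :=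
  upper_row (P^T *m sym_of_row r *m P).

Lemma congr_row_linear (R : comNzRingType) (P : 'M[R]_g) : linear (congr_row P).
Proof.
move=> c r s; rewrite /congr_row !linearP /= mulmxDl -scalemxAl.
by rewrite linearP.
Qed.

HB.instance Definition _ (R : comNzRingType) (P : 'M[R]_g) :=
  GRing.isLinear.Build R 'rV[R]_(symdim g) 'rV[R]_(symdim g) _ (congr_row P)
    (congr_row_linear P).

Definition congr_mx (R : comNzRingType) (P : 'M[R]_g) : 'M[R]_(symdim g) :=
  lin1_mx (congr_row P).

Lemma mul_congr_mx (R : comNzRingType) (P : 'M[R]_g) (r : 'rV_(symdim g)) :
  sym_of_row (r *m congr_mx P) = P^T *m sym_of_row r *m P.
Proof.
rewrite mul_rV_lin1 /= /congr_row upper_rowK //.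
by rewrite !trmx_mul trmxK tr_sym_of_row mulmxA.
Qed.

Lemma congr_mxM (R : comNzRingType) (P Q : 'M[R]_g) :
  congr_mx (P *m Q) = congr_mx P *m congr_mx Q.
Proof.
apply/row_matrixP => a; rewrite !rowE mulmxA.
apply: (can_inj (@sym_of_rowK g R)).
by rewrite !mul_congr_mx trmx_mul !mulmxA.
Qed.

Lemma sym_of_row_delta (R : nzRingType) a k l :
  sym_of_row (delta_mx 0 a : 'rV[R]_(symdim g)) k l =
  (pair_of a \in [:: (k, l); (l, k)])%:R.
Proof.
rewrite mxE big_mkcond (bigD1 a) //= big1 ?addr0 => [|b ba].
  by rewrite mxE !eqxx; case: ifP.
by rewrite mxE (negPf ba) andbF if_same.
Qed.

Lemma congr_mxE (R : comNzRingType) (P : 'M[R]_g) a b :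
  congr_mx P a b = \sum_p (pair_of a \in [:: p; (p.2, p.1)])%:R *
    (P p.1 (pair_of b).1 * P p.2 (pair_of b).2).
Proof.
rewrite /congr_mx mxE /congr_row mxE mxE.
rewrite -(pair_bigA _ (fun i j => (pair_of a \in [:: (i, j); (j, i)])%:R *
    (P i (pair_of b).1 * P j (pair_of b).2))) exchange_big /=.
apply: eq_bigr => j _; rewrite mxE big_distrl /=; apply: eq_bigr => i _.
by rewrite sym_of_row_delta mxE mulrCA mulrA.
Qed.

Lemma pair_of_mem_swap (a : 'I_(symdim g)) p :
  pair_of a \in [:: p; (p.2, p.1)] -> (p.1 <= p.2)%N -> pair_of a = p.
Proof.
case: p => i j; rewrite !inE => /orP[/eqP// | /eqP/= aE] ij.
have := pair_of_le a; rewrite aE /= => ji.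
by have -> : i = j by apply/val_inj/eqP; rewrite eqn_leq ij ji.
Qed.

(** The index [i] occurs once in each of the [g - 1] pairs joining it to another
    index, and twice in [(i, i)]. *)
Lemma prod_pair_of (R : comNzRingType) (d : 'I_g -> R) :
  \prod_a (d (pair_of a).1 * d (pair_of a).2) = (\prod_i d i) ^+ g.+1.
Proof.
rewrite (big_pair_of _ (fun p => d p.1 * d p.2)) big_split /=.
have -> : \prod_(p : 'I_g * 'I_g | (p.1 <= p.2)%N) d p.2 =
          \prod_(p : 'I_g * 'I_g | (p.2 <= p.1)%N) d p.1.
  by rewrite (reindex_inj (h := fun p => (p.2, p.1))) // => -[i j] [k l] [-> ->].
rewrite -(pair_big_dep xpredT (fun i j : 'I_g => i <= j)%N (fun i _ => d i)) /=.
rewrite -(pair_big_dep xpredT (fun i j : 'I_g => j <= i)%N (fun i _ => d i)) /=.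
rewrite -big_split -prodrXl /=; apply: eq_bigr => i _.
rewrite !prodr_const -exprD; congr (_ ^+ _).
rewrite -cardUI [X in (X + _)%N](_ : _ = g) ?[X in (_ + X)%N](_ : _ = 1%N) ?addn1 //.
  rewrite -[RHS](card1 i); apply: eq_card => j; rewrite !inE -eqn_leq.
  by rewrite eq_sym.
rewrite -[RHS]card_ord; apply: eq_card => j; rewrite !inE.
exact: leq_total.
Qed.

(** Lower and upper triangular matrices are both covered, through the choice of
    [e].  If [P] is triangular for [e], then [congr_mx P] is triangular for the
    weight [e k + e l] of the pair [(k, l)], with diagonal entries [P k k * P l l]. *)
Lemma det_congr_triangular (R : comNzRingType) (P : 'M[R]_g) (e : 'I_g -> nat) :
  injective e -> (forall i k, P i k != 0 -> (e i <= e k)%N) ->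
  \det (congr_mx P) = \det P ^+ g.+1.
Proof.
move=> e_inj Pe.
pose w (a : 'I_(symdim g)) := (e (pair_of a).1 + e (pair_of a).2)%N.
(* Nonzero terms of the sum [congr_mxE] never lower the weight, and those that
   preserve it sit on the diagonal, one for each diagonal entry. *)
have contrib a b p : (pair_of a \in [:: p; (p.2, p.1)])%:R *
    (P p.1 (pair_of b).1 * P p.2 (pair_of b).2) != 0 ->
    (w a <= w b)%N /\ (w a = w b -> p = pair_of b /\ a = b).
  have [pa|_] := boolP (_ \in _); last by rewrite mul0r eqxx.
  have wa : w a = (e p.1 + e p.2)%N.
    by move: pa; rewrite /w !inE => /orP[] /eqP-> //=; rewrite addnC.
  rewrite mul1r wa => nz.
  have k1 : (e p.1 <= e (pair_of b).1)%N.
    by apply: Pe; apply: contraNneq nz => ->; rewrite mul0r.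
  have k2 : (e p.2 <= e (pair_of b).2)%N.
    by apply: Pe; apply: contraNneq nz => ->; rewrite mulr0.
  split=> [|wE]; first exact: leq_add.
  have pE : p = pair_of b.
    have sum_eq (x1 x2 y1 y2 : nat) : (x1 <= y1)%N -> (x2 <= y2)%N ->
      (x1 + x2 = y1 + y2)%N -> x1 = y1 /\ x2 = y2 by lia.
    have [/e_inj p1 /e_inj p2] := sum_eq _ _ _ _ k1 k2 wE.
    by rewrite [p]surjective_pairing p1 p2 -surjective_pairing.
  split=> //; apply: pair_of_inj; rewrite -pE.
  by apply: pair_of_mem_swap => //; rewrite pE pair_of_le.
rewrite (det_graded_triangular (M := P) (w := e)) => [|i k /Pe ik]; last first.
  by split=> // /e_inj.
rewrite (det_graded_triangular (w := w)) => [|a b].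
  rewrite -prod_pair_of; apply: eq_bigr => a _.
  rewrite congr_mxE (bigD1 (pair_of a)) //= big1 ?addr0 => [|p pa].
    by rewrite inE eqxx mul1r.
  apply: contraNeq pa => /contrib [_ /(_ erefl) [pE _]].
  by rewrite pE eqxx.
rewrite congr_mxE => nz.
have [/forallP /= z|] := boolP [forall p,
    (pair_of a \in [:: p; (p.2, p.1)])%:R *
    (P p.1 (pair_of b).1 * P p.2 (pair_of b).2) == 0].
  by rewrite big1 ?eqxx // in nz => p _; apply/eqP.
by rewrite negb_forall => /existsP [p /contrib [? wE]]; split=> // /wE[].
Qed.

Lemma det_congr_field (F : fieldType) (P : 'M[F]_g) :
  \det (congr_mx P) = \det P ^+ g.+1.
Proof.
elim: (field_trig_product P)
  => [A /is_trig_mxP tA|A /is_trig_mxP tA|A B _ IHA _ IHB].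
- apply: (det_congr_triangular (e := fun i : 'I_g => (g - i)%N)) => [i k|i k].
    by move=> ik; apply/val_inj => /=; have := ltn_ord i; have := ltn_ord k; lia.
  by apply: contra_neqT; rewrite leqNgt negbK => lt; apply: tA; lia.
- apply: (det_congr_triangular (e := fun i : 'I_g => i)) => [|i k].
    exact: val_inj.
  apply: contra_neqT; rewrite -ltnNge => lt.
  by rewrite -(trmxK A) mxE; apply: tA.
- by rewrite congr_mxM !det_mulmx IHA IHB exprMn.
Qed.

Lemma map_congr_mx (R S : comNzRingType) (f : {rmorphism R -> S}) (P : 'M[R]_g) :
  map_mx f (congr_mx P) = congr_mx (map_mx f P).
Proof.
apply/matrixP => a b; rewrite mxE !congr_mxE rmorph_sum; apply: eq_bigr => p _.
by rewrite !rmorphM rmorph_nat !mxE.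
Qed.

(** Both sides are polynomial in the entries, so the fraction field suffices. *)
Lemma det_congr (R : idomainType) (P : 'M[R]_g) :
  \det (congr_mx P) = \det P ^+ g.+1.
Proof.
apply/eqP; rewrite -tofrac_eq rmorphXn -!det_map_mx map_congr_mx.
by rewrite det_congr_field.
Qed.

(** The diagonal of the Gram matrix of the trace form, in the coordinates on and
    above the diagonal: an entry off the diagonal is counted twice. *)
Definition pair_weight (R : nzRingType) : 'rV[R]_(symdim g) :=
  \row_a (if (pair_of a).1 == (pair_of a).2 then 1 else 2%:R).

Lemma mxtrace_sym (R : comNzRingType) (r s : 'rV[R]_(symdim g)) :
  \tr (sym_of_row r *m sym_of_row s) = (r *m diag_mx (pair_weight R) *m s^T) 0 0.
Proof.
set A := sym_of_row r; set B := sym_of_row s.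
have As : A^T = A by exact: tr_sym_of_row.
have Bs : B^T = B by exact: tr_sym_of_row.
have -> : \tr (A *m B) = \sum_(p : 'I_g * 'I_g) A p.1 p.2 * B p.1 p.2.
  rewrite -(pair_bigA _ (fun i j => A i j * B i j)); apply: eq_bigr => i _.
  rewrite mxE; apply: eq_bigr => j _.
  by rewrite -{1}Bs [B^T _ _]mxE.
rewrite mul_mx_diag mxE (bigID (fun p : 'I_g * 'I_g => (p.1 <= p.2)%N)) /=.
have -> : \sum_(p : 'I_g * 'I_g | ~~ (p.1 <= p.2)%N) A p.1 p.2 * B p.1 p.2 =
   \sum_(p : 'I_g * 'I_g | (p.1 <= p.2)%N)
      (if p.1 == p.2 then 0 else A p.1 p.2 * B p.1 p.2).
  rewrite (reindex_inj (h := fun p => (p.2, p.1))) => [|[i j] [k l] [-> ->] //] /=.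
  rewrite big_mkcond [RHS]big_mkcond; apply: eq_bigr => -[i j] _ /=.
  rewrite -ltnNge ltn_neqAle -val_eqE /=.
  rewrite -{1}As -{1}Bs ![_^T j i]mxE.
  by case: eqP; case: leqP.
rewrite -big_split /= -(big_pair_of _ (fun p => A p.1 p.2 * B p.1 p.2 +
   (if p.1 == p.2 then 0 else A p.1 p.2 * B p.1 p.2))) /=.
apply: eq_bigr => a _; rewrite /A /B !sym_of_row_pair !mxE.
by case: eqP => _; rewrite ?addr0 ?mulr1 // mulr_natr mulrnAl mulr2n.
Qed.

Lemma det_pair_weight (R : comNzRingType) :
  \det (diag_mx (pair_weight R)) = 2%:R ^+ ((g * g.-1)./2)%N.
Proof.
rewrite det_diag; under eq_bigr do rewrite mxE.
rewrite (big_pair_of _ (fun p => if p.1 == p.2 then 1 else 2%:R)) /=.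
under eq_bigr do rewrite -if_neg.
rewrite -big_mkcondr /= prodr_const; congr (_ ^+ _).
set strict := #|_|; suff : symdim g = (g + strict)%N.
  have -> : symdim g = ((g * g.-1)./2 + g)%N; last by lia.
  rewrite /symdim; have -> : (g * g.+1 = g * g.-1 + g.*2)%N.
    by case: (g) => // n; lia.
  by rewrite halfD odd_double andbF doubleK.
rewrite -(card_upper_pair g) -(cardID [pred p : 'I_g * 'I_g| p.1 == p.2]).
congr (_ + _)%N; last by apply: eq_card => p; rewrite !inE andbC.
rewrite -[RHS]card_ord -(card_imset (f := fun i : 'I_g => (i, i))) => [|i j []//].
apply: eq_card => -[i j]; rewrite !inE /=.
apply/andP/imsetP => [[_ /eqP<-]|[k _ [-> ->]]]; first by exists i.
by split=> //; apply: leqnn.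
Qed.

(** The Gram matrix, in the family of rows of [Y], of the quadratic form
    [A |-> \tr (P A P A)] on symmetric matrices. *)
Definition gram (R : comNzRingType) (P : 'M[R]_g) (Y : 'M[R]_(symdim g)) :=
  \matrix_(i, j) \tr (P *m sym_of_row (row i Y) *m (P *m sym_of_row (row j Y))).

(** For symmetric [P], [\tr (P A P B)] is the trace form applied to the congruence
    transform [P A P] of [A] and to [B]. *)
Lemma det_gram (R : idomainType) (P : 'M[R]_g) (Y : 'M[R]_(symdim g)) :
  P^T = P ->
  \det (gram P Y) = 2%:R ^+ ((g * g.-1)./2)%N * \det P ^+ g.+1 * \det Y ^+ 2.
Proof.
move=> Ps.
have -> : gram P Y = Y *m congr_mx P *m diag_mx (pair_weight R) *m Y^T.
  apply/matrixP => i j; rewrite mxE mulmxA -{1}Ps -mul_congr_mx mxtrace_sym.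
  by rewrite [RHS]mxE mxE; apply: eq_bigr => a _; rewrite -!row_mul !mxE.
rewrite !det_mulmx det_tr det_congr det_pair_weight; ring.
Qed.

End Congruence.

(** * Derivatives of determinants *)

Section Derivation.
Variables (R : comNzRingType) (d : {additive R -> R}).
Hypothesis dM : forall x y, d (x * y) = d x * y + x * d y.

Lemma derivation1 : d 1 = 0.
Proof.
apply: (addrI (d 1)); rewrite addr0 -[X in X + _]mulr1 -[X in _ + X]mul1r.
by rewrite -dM mul1r.
Qed.

Lemma derivation_sign n : d ((-1) ^+ n) = 0.
Proof.
by rewrite -signr_odd; case: odd; rewrite ?expr1 ?raddfN /= derivation1 ?oppr0.
Qed.

Lemma derivation_prod n (f : 'I_n -> R) :
  d (\prod_i f i) = \sum_i \prod_j (if j == i then d (f j) else f j).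
Proof.
elim: n f => [|n IHn] f; first by rewrite !big_ord0 derivation1.
rewrite big_ord_recl dM IHn [RHS]big_ord_recl /=; congr (_ + _).
  by rewrite big_ord_recl eqxx; congr (_ * _); apply: eq_bigr => j _.
rewrite mulr_sumr; apply: eq_bigr => i _; rewrite big_ord_recl /=.
by congr (_ * _); apply: eq_bigr => j _; rewrite (inj_eq lift_inj).
Qed.

(** Jacobi's formula: the derivation acts on one row at a time, and each of the
    resulting determinants is expanded along that row. *)
Lemma derivation_det n (X : 'M[R]_n) :
  d (\det X) = \tr (\adj X *m map_mx d X).
Proof.
pose Xi i := \matrix_(k, l) (if k == i then d (X k l) else X k l).
transitivity (\sum_i \det (Xi i)).
  rewrite raddf_sum exchange_big /=; apply: eq_bigr => s _.
  rewrite dM derivation_sign mul0r add0r derivation_prod mulr_sumr.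
  apply: eq_bigr => i _; congr (_ * _); apply: eq_bigr => k _.
  by rewrite mxE.
rewrite mxtrace_mulC; apply: eq_bigr => i _; rewrite mxE (expand_det_row _ i).
apply: eq_bigr => j _; rewrite !mxE eqxx; congr (_ * _).
congr (_ * \det _); apply/matrixP => k l; rewrite !mxE.
by rewrite eq_sym (negPf (neq_lift _ _)).
Qed.

Lemma derivation_mulmx m n p (A : 'M[R]_(m, n)) (B : 'M[R]_(n, p)) :
  map_mx d (A *m B) = map_mx d A *m B + A *m map_mx d B.
Proof.
apply/matrixP => i j; rewrite !mxE raddf_sum -big_split /=.
by apply: eq_bigr => k _; rewrite dM !mxE.
Qed.

(** Derive [X *m \adj X = (\det X)%:M] and multiply on the left by [\adj X]; this
    avoids dividing by the determinant. *)
Lemma derivation_adj n (X : 'M[R]_n) :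
  \det X *: map_mx d (\adj X) =
  d (\det X) *: \adj X - \adj X *m map_mx d X *m \adj X.
Proof.
have := congr1 (mulmx (\adj X)) (congr1 (map_mx d) (mul_mx_adj X)).
rewrite derivation_mulmx mulmxDr !mulmxA mul_adj_mx mul_scalar_mx.
have -> : map_mx d (\det X)%:M = (d (\det X))%:M.
  by move=> k; apply/matrixP => i j; rewrite !mxE raddfMn.
by rewrite mul_mx_scalar => <-; rewrite addrC addKr.
Qed.

End Derivation.

(** The left-hand side is [(\det X) ^+ 2 * d1 (d2 (log (\det X)))].  By Jacobi's
    formula [d2 (log (\det X))] is the trace of [X^-1 (d2 X)]; as [d2 X] is
    killed by [d1], only the derivative of [X^-1] remains. *)
Lemma hessian_log_det (R : comNzRingType) (d1 d2 : {additive R -> R}) n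
    (X : 'M[R]_n) :
  (forall x y, d1 (x * y) = d1 x * y + x * d1 y) ->
  (forall x y, d2 (x * y) = d2 x * y + x * d2 y) ->
  map_mx d1 (map_mx d2 X) = 0 ->
  \det X * d1 (d2 (\det X)) - d1 (\det X) * d2 (\det X) =
  - \tr (\adj X *m map_mx d1 X *m (\adj X *m map_mx d2 X)).
Proof.
move=> d1M d2M dd0; rewrite (derivation_det d2M).
have dtr m (A : 'M[R]_m) : d1 (\tr A) = \tr (map_mx d1 A).
  by rewrite raddf_sum; apply: eq_bigr => i _; rewrite mxE.
rewrite dtr (derivation_mulmx d1M) dd0 mulmx0 addr0.
rewrite -mxtraceZ scalemxAl (derivation_adj d1M) mulmxBl raddfB /=.
by rewrite -scalemxAl mxtraceZ addrAC subrr add0r !mulmxA.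
Qed.

(** * The characteristic polynomial vanishes identically *)

Module KEvanishing.
Import mpoly.

Section Vanishing.
Variables (S : idomainType) (g : nat) (Y : 'M[S]_(symdim g)).
Hypothesis g_gt1 : (1 < g)%N.
Local Notation N := (symdim g).
Local Notation X :=
  (\sum_(i < N) 'X_i *: map_mx (mpolyC N (R := S)) (sym_of_row (row i Y))).

Lemma tr_genericX : X^T = X.
Proof.
apply/matrixP => k l; rewrite mxE !summxE; apply: eq_bigr => i _.
rewrite -[in RHS]tr_sym_of_row mxE [in LHS]mxE [RHS]mxE [in RHS]mxE.
by rewrite [in RHS]mxE.
Qed.

Lemma mderiv_var i j : ('X_j : {mpoly S[N]})^`M(i) = (j == i)%:R.
Proof.
rewrite mderivX mnm1E; case: eqP => [->|_]; last by rewrite scale0r.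
have -> : (U_(i) - U_(i) = 0)%MM by apply/mnmP => k; rewrite mnmBE subnn mnm0E.
by rewrite mpolyX0 scale1r.
Qed.

Lemma mderiv_genericX i :
  map_mx (mderiv i) X = sym_of_row (row i (map_mx (mpolyC N (R := S)) Y)).
Proof.
apply/matrixP => k l; rewrite mxE summxE raddf_sum (bigD1 i) //= big1 => [|j ji].
  rewrite addr0 -map_row -map_sym_of_row mxE mderivM !mxE mderivC mulr0 addr0.
  by rewrite mderiv_var eqxx mul1r.
rewrite mxE mderivM !mxE mderivC mulr0 addr0.
by rewrite mderiv_var (negPf ji) mul0r.
Qed.

Lemma KEpoly_eq0 : KE.KEpoly Y = 0.
Proof.
rewrite /KE.KEpoly /KE.detF; set F := \det X; set P := \adj X.
set Y' := map_mx (mpolyC N (R := S)) Y.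
have N_gt0 : (0 < N)%N by rewrite /symdim; nia.
(* When [F] vanishes both terms do; otherwise [F] can be cancelled in
   [F * \det P = F ^+ g], which gives the determinant of the adjugate. *)
have [F0|F_neq0] := eqVneq F 0.
  rewrite (_ : \matrix_(i, j) _ = 0) => [|]; last first.
    by apply/matrixP => i j; rewrite !mxE F0 mul0r raddf0 mul0r subr0.
  rewrite -(scale0r (0 : 'M_N)) detZ F0 !expr0n !gtn_eqF ?muln_gt0 ?N_gt0 //;
    last by lia.
  by rewrite mulr0 !mul0r subr0.
have -> : \matrix_(i < N, j < N) (F * F^`M(j)^`M(i) - F^`M(i) * F^`M(j)) =
    -1 *: gram P Y'.
  apply/matrixP => i j; rewrite !mxE mulN1r.
  rewrite (hessian_log_det (mderivM i) (mderivM j)) ?mderiv_genericX //.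
  by apply/matrixP => k l; rewrite -map_row -map_sym_of_row !mxE; exact: mderivC.
have Ps : P^T = P by rewrite trmx_adj tr_genericX.
rewrite detZ det_gram // det_map_mx.
have detP : \det P = F ^+ g.-1.
  apply: (mulfI F_neq0); rewrite -det_mulmx mul_mx_adj det_scalar -exprS.
  by congr (_ ^+ _); lia.
rewrite detP -exprM; apply/eqP; rewrite subr_eq0 [(g.+1 * _)%N]mulnC; apply/eqP.
ring.
Qed.

End Vanishing.

Lemma KEcoef_eq0 g (m : 'X_{1.. symdim g}) :
  (1 < g)%N -> KE.KEcoef m = 0.
Proof. by move=> g1; rewrite /KE.KEcoef KEpoly_eq0 // mcoeff0. Qed.

End KEvanishing.

Lemma Ag_of_det_neq0 (F : fieldType) g (Z : 'M[F]_(symdim g)) :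
  (1 < g)%N -> \det Z != 0 -> KE.Ag Z.
Proof.
move=> g1 Z0; split=> // m _.
by rewrite /KE.KEcoef_at KEvanishing.KEcoef_eq0 // mpoly.mmap0.
Qed.

(** * The unipotent Lie algebra of the standard minimal cusp *)

From mathcomp Require Import all_classical all_reals all_analysis.
Local Open Scope classical_set_scope.
Local Open Scope ring_scope.
Local Open Scope complex_scope.

Lemma intR_inj (R : realType) m n : injective (@intR R m n).
Proof.
move=> A B /matrixP AB; apply/matrixP => i j.
by have := AB i j; rewrite !mxE => /intr_inj.
Qed.

Section Unipotent.
Variables (R : realType) (g : nat).

Lemma W0_dsubmx (v : 'cV[R]_(g + g)) : v \in W0 g R -> dsubmx v = 0.
Proof.
have : (W0 g R <= lker (linfun (@dsubmx R g g 1)))%VS.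
  apply/span_subvP => _ /mapP [i _ ->]; rewrite memv_ker lfunE /=.
  by apply/eqP/matrixP => k l; rewrite !mxE eq_rlshift.
by move=> /subvP sub /sub; rewrite memv_ker lfunE /= => /eqP.
Qed.

Lemma psi_W0 (v w : 'cV[R]_(g + g)) :
  v \in W0 g R -> w \in W0 g R -> psi v w = 0.
Proof.
move=> /W0_dsubmx v0 /W0_dsubmx w0; rewrite /psi -(vsubmxK v) -(vsubmxK w) v0 w0.
rewrite tr_col_mx trmx0 /Jmx mul_row_block !mulmx0 !mul0mx !addr0 mul_row_col.
by rewrite !mul0mx mulmx0 addr0 mxE.
Qed.

(** The columns of [x] lie in [W0], so the lower blocks vanish; [W0] is contained
    in its own orthogonal, so the left blocks vanish; what is left of the
    symplectic condition is the symmetry of the upper right block. *)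
Lemma uF_W0P (x : 'M[R]_(g + g)) : uF (W0 g R) x ->
  x = block_mx 0 (ursubmx x) 0 0 /\ (ursubmx x)^T = ursubmx x.
Proof.
move=> [xJ xW xperp].
have x0 : x = block_mx 0 (ursubmx x) 0 0.
  have dx : dsubmx x = 0.
    apply/matrixP => i j.
    have /W0_dsubmx/matrixP/(_ i 0) := xW (delta_mx j 0).
    by rewrite -[x in x *m _]vsubmxK mul_col_mx col_mxKd -colE !mxE.
  have lx : lsubmx x = 0.
    apply/matrixP => i j.
    have ej : (delta_mx (lshift g j) 0 : 'cV[R]_(g + g)) \in W0 g R.
      by apply/memv_span/mapP; exists j; rewrite ?mem_enum.
    have /xperp /matrixP /(_ i 0) : perp (W0 g R) (delta_mx (lshift g j) 0).
      by move=> w Ww; exact: psi_W0.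
    by rewrite -colE !mxE.
  rewrite -[LHS]submxK -[dlsubmx x]/(lsubmx (dsubmx x)).
  rewrite -[drsubmx x]/(rsubmx (dsubmx x)).
  rewrite dx !linear0; congr (block_mx _ _ 0 0).
  by apply/matrixP => i j; move/matrixP/(_ (lshift g i) j): lx; rewrite !mxE.
split=> //; move: xJ; rewrite {1 2}x0 tr_block_mx !trmx0 /Jmx !mulmx_block.
rewrite add_block_mx -[0 in RHS]block_mx0 => /eq_block_mx [_ _ _].
rewrite !mulmx0 mul1mx mulmxN mulmx1 !addr0 addrC => /eqP.
by rewrite subr_eq0 => /eqP/esym.
Qed.

End Unipotent.

(** * Integral bases and the cones they generate *)

Section UnipotentLattice.
Variables (R : realType) (g : nat) (Gamma : set 'M[int]_(g + g)).
Local Notation N := (symdim g).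
Local Notation lattice := (ulattice Gamma (W0 g R)).

Definition ucoord (K : nzRingType) (x : 'M[K]_(g + g)) : 'rV[K]_(symdim g) :=
  upper_row (ursubmx x).

Definition of_ucoord (K : nzRingType) (r : 'rV[K]_(symdim g)) : 'M[K]_(g + g) :=
  block_mx 0 (sym_of_row r) 0 0.

Lemma ucoordK : {in lattice, cancel (@ucoord int) (@of_ucoord int)}.
Proof.
move=> x /set_mem [/uF_W0P [x0 xs] _].
rewrite /of_ucoord /ucoord upper_rowK.
  by apply: (@intR_inj R); rewrite /intR map_block_mx !map_mx0 map_ursubmx -x0.
by apply: (@intR_inj R); rewrite /intR -map_trmx map_ursubmx.
Qed.

Lemma ucoord_linear (K : nzRingType) : linear (@ucoord K).
Proof. by move=> c x y; apply/rowP => a; rewrite !mxE. Qed.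

HB.instance Definition _ (K : nzRingType) := GRing.isLinear.Build K
  'M[K]_(g + g) 'rV[K]_(symdim g) _ (@ucoord K) (@ucoord_linear K).

Lemma of_ucoord_linear (K : nzRingType) : linear (@of_ucoord K).
Proof.
move=> c x y; rewrite /of_ucoord linearP scale_block_mx add_block_mx.
by rewrite !scaler0 !addr0.
Qed.

HB.instance Definition _ (K : nzRingType) := GRing.isLinear.Build K
  'rV[K]_(symdim g) 'M[K]_(g + g) _ (@of_ucoord K) (@of_ucoord_linear K).

(** When [n = N] this is [row_matrix l]; other lengths occur before the bases of
    the lattice are known to have [N] elements. *)
Definition coord_mx n (l : 'I_n -> 'M[int]_(g + g)) : 'M[int]_(n, N) :=
  \matrix_k ucoord (l k).

Lemma mul_coord_mx n (l : 'I_n -> 'M[int]_(g + g)) (c : 'rV[int]_n) :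
  c *m coord_mx l = ucoord (\sum_k l k *~ c 0 k).
Proof.
rewrite mulmx_sum_row linear_sum; apply: eq_bigr => k _.
by rewrite rowK raddfMz -scaler_int intz.
Qed.

Lemma ucoord_inj x y : lattice x -> lattice y -> ucoord x = ucoord y -> x = y.
Proof.
move=> xL yL xy; rewrite -[x]ucoordK ?inE // xy ucoordK ?inE //.
Qed.

Hypothesis Gamma1 : Gamma 1%:M.

Lemma lattice0 : lattice 0.
Proof.
split; last by rewrite addr0.
rewrite /intR map_mx0; split => [|v|v _]; rewrite ?mul0mx ?mem0v //.
by rewrite trmx0 mul0mx mulmx0 addr0.
Qed.

Section Basis.
Variables (n : nat) (l : 'I_n -> 'M[int]_(g + g)).
Hypothesis l_basis : lattice_basis Gamma (W0 g R) l.

(** A relation between the rows gives coordinates of the zero vector, which are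
    unique. *)
Lemma coord_mx_free (c : 'rV[int]_n) : c *m coord_mx l = 0 -> c = 0.
Proof.
case: l_basis => l_in l_gen c0.
have lc : \sum_k l k *~ c 0 k = 0.
  transitivity (of_ucoord (ucoord (\sum_k l k *~ c 0 k))).
    rewrite !linear_sum; apply: eq_bigr => k _.
    by rewrite !raddfMz /= ucoordK // inE.
  by rewrite -mul_coord_mx c0 linear0.
have [c' [_ c'_uniq]] := l_gen _ lattice0.
apply/rowP => k; rewrite mxE.
have /(_ [ffun k => c 0 k]) := c'_uniq; rewrite (c'_uniq [ffun=> 0]).
  move=> /(_ _) /ffunP /(_ k); rewrite !ffunE => -> //.
  by rewrite -[LHS]lc; apply: eq_bigr => i _; rewrite ffunE.
by rewrite big1 // => i _; rewrite ffunE mulr0z.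
Qed.

Lemma basis_size : (n <= N)%N.
Proof.
rewrite leqNgt; apply/negP => ltNn.
(* The coordinate matrix padded with zero columns to a square one is singular. *)
pose A : 'M[int]_n := \matrix_(k, j)
  (if insub (j : nat) is Some a then coord_mx l k a else 0).
have : \det A = 0.
  rewrite (expand_det_col _ (Ordinal ltNn)) big1 // => k _.
  by rewrite mxE insubN ?mul0r //= ltnn.
move/eqP/det0P => [c c_neq0 cA0]; case/eqP: c_neq0; apply: coord_mx_free.
apply/rowP => a; rewrite [RHS]mxE.
have : (c *m A) 0 (widen_ord (ltnW ltNn) a) = 0 by rewrite cA0 mxE.
move=> <-; rewrite !mxE; apply: eq_bigr => k _; congr (_ * _).
by rewrite [RHS]mxE /= insubT //= => lt; congr (coord_mx l k _); apply/val_inj.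
Qed.

End Basis.

Section FullBasis.
Variables (l : 'I_N -> 'M[int]_(g + g)).
Hypothesis l_basis : lattice_basis Gamma (W0 g R) l.

Lemma det_coord_mx : \det (coord_mx l) != 0.
Proof.
apply/negP => /det0P [c /eqP c_neq0 cl0].
by apply: c_neq0; apply: coord_mx_free l_basis _ cl0.
Qed.

(** The nonvanishing integer determinant carries freeness from the integers to
    the reals. *)
Lemma basis_free_real (c d : 'I_N -> R) :
  \sum_k c k *: intR R (l k) = \sum_k d k *: intR R (l k) -> c =1 d.
Proof.
have coordE (e : 'I_N -> R) : ucoord (\sum_k e k *: intR R (l k)) =
    (\row_k e k) *m intR R (coord_mx l).
  rewrite mulmx_sum_row linear_sum; apply: eq_bigr => k _.
  by rewrite linearZ /= mxE; congr (_ *: _); apply/rowP => a; rewrite !mxE.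
move/(congr1 (@ucoord R)); rewrite !coordE.
have unit : intR R (coord_mx l) \in unitmx.
  by rewrite unitmxE det_map_mx unitfE intr_eq0 det_coord_mx.
move/(can_inj (mulmxK unit)) => /rowP cd k.
by have := cd k; rewrite !mxE.
Qed.

End FullBasis.

(** If [P i j] and [Q j k] are both positive, then so is [(P *m Q) i k], and
    [k = i].  Hence, [f i] being the position of a nonzero entry of row [i] of [P],
    row [f i] of [Q] is supported at [i], and [Q *m P = 1] then forces row [i] of
    [P] to be the basis vector at [f i]. *)
Lemma nonneg_inverse_perm n (P Q : 'M[int]_n) :
  (forall i j, 0 <= P i j) -> (forall i j, 0 <= Q i j) ->
  P *m Q = 1%:M -> Q *m P = 1%:M -> exists s, P = perm_mx s.
Proof.
move=> P0 Q0 PQ QP.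
have entry (A B : 'M[int]_n) i j k : (forall i j, 0 <= A i j) ->
    (forall i j, 0 <= B i j) -> A *m B = 1%:M -> i != k -> A i j * B j k = 0.
  move=> A0 B0 /matrixP /(_ i k); rewrite !mxE => + /negPf ik; rewrite ik.
  move/psumr_eq0P => ->// a _; exact: mulr_ge0.
have rowP_neq0 i : exists j, P i j != 0.
  apply/existsP; apply: contraT; rewrite negb_exists => /forallP z.
  move/matrixP/(_ i i): PQ; rewrite !mxE eqxx big1 // => j _.
  by have := z j; rewrite negbK => /eqP->; rewrite mul0r.
pose f i := xchoose (rowP_neq0 i).
have f_neq0 i : P i (f i) != 0 by exact: (xchooseP (rowP_neq0 i)).
have colQ i k : k != i -> Q (f i) k = 0.
  rewrite eq_sym => ki; have /eqP := entry P Q i (f i) k P0 Q0 PQ ki.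
  by rewrite mulf_eq0 (negPf (f_neq0 i)) => /eqP.
have QPE i j : Q (f i) i * P i j = (f i == j)%:R.
  move/matrixP/(_ (f i) j): QP; rewrite !mxE (bigD1 i) //= big1 ?addr0 // => k ki.
  by rewrite colQ // mul0r.
have P1 i : P i (f i) = 1.
  have /(congr1 absz)/eqP := QPE i (f i); rewrite eqxx abszM muln_eq1.
  by move=> /andP[_ /eqP P1]; rewrite -[LHS]gez0_abs // P1.
have f_inj : injective f.
  move=> i k fik; apply/eqP; apply: contraT => /eqP ik.
  have := QPE i (f i); rewrite fik colQ ?mul0r ?eqxx //; by apply/eqP.
exists (perm f_inj); apply/matrixP => i j; rewrite !mxE permE.
have := QPE i j; case: eqP => [<- _|/eqP fij /eqP]; first by rewrite P1.
rewrite mulf_eq0 => /orP[/eqP Q00|/eqP->//].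
by have := QPE i (f i); rewrite Q00 mul0r eqxx.
Qed.

Lemma basis_change (l l' : 'I_N -> 'M[int]_(g + g)) :
  lattice_basis Gamma (W0 g R) l -> (forall k, lattice (l' k)) ->
  exists P : 'M[int]_N, coord_mx l' = P *m coord_mx l /\
    forall k, intR R (l' k) = \sum_j (P k j)%:~R *: intR R (l j).
Proof.
move=> [_ l_gen] l'_in.
have /choice [c cE] k : exists c : {ffun 'I_N -> int}, l' k = \sum_j l j *~ c j.
  by have [c [cE _]] := l_gen _ (l'_in k); exists c.
exists (\matrix_(k, j) c k j); split.
  apply/row_matrixP => k; rewrite row_mul mul_coord_mx rowK cE.
  by congr ucoord; apply: eq_bigr => j _; rewrite !mxE.
move=> k; rewrite {1}cE; apply/matrixP => a b; rewrite mxE !summxE rmorph_sum.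
by apply: eq_bigr => j _; rewrite -scaler_int intz !mxE rmorphM.
Qed.

Lemma cone_gen_reindex (I J : finType) (h : J -> I) (v : I -> 'M[R]_(g + g)) :
  bijective h -> cone_gen (v \o h) = cone_gen v.
Proof.
move=> [h' hK h'K]; apply/seteqP; split => x [c c0 ->].
  exists (c \o h') => [i|]; first exact: c0.
  by rewrite [RHS](reindex h) /=;
    [apply: eq_bigr => j _; rewrite hK | exists h' => ? _].
exists (c \o h) => [i|]; first exact: c0.
by rewrite (reindex h) //=; exists h' => ? _.
Qed.

(** The generators of a simplicial cone which form a basis of the lattice are
    determined by the cone: the coordinates of one family on the other are
    integers because both are bases, and non-negative because the cones agree. *)
Lemma basis_of_cone_unique (l l' : 'I_N -> 'M[int]_(g + g)) :
  lattice_basis Gamma (W0 g R) l -> lattice_basis Gamma (W0 g R) l' ->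
  cone_gen (fun k => intR R (l k)) = cone_gen (fun k => intR R (l' k)) ->
  exists s : 'S_N, l' =1 l \o s.
Proof.
move=> lB l'B cone_eq.
have [P [PE PR]] := basis_change lB l'B.1.
have [Q [QE QR]] := basis_change l'B lB.1.
have gen_in (v : 'I_N -> 'M[R]_(g + g)) k : cone_gen v (v k).
  exists (fun j => (j == k)%:R) => [j|]; first exact: ler0n.
  rewrite (bigD1 k) //= eqxx scale1r big1 ?addr0 // => j /negPf->.
  by rewrite scale0r.
have nonneg (m m' : 'I_N -> 'M[int]_(g + g)) (A : 'M[int]_N) :
    lattice_basis Gamma (W0 g R) m ->
    cone_gen (fun k => intR R (m k)) = cone_gen (fun k => intR R (m' k)) ->
    (forall k, intR R (m' k) = \sum_j (A k j)%:~R *: intR R (m j)) ->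
    forall i j, 0 <= A i j.
  move=> mB ce AE i j; have := gen_in (fun k => intR R (m' k)) i.
  rewrite -ce => -[c c0]; rewrite AE => /(basis_free_real mB) /(_ j) cA.
  by rewrite -(ler0z R) cA.
have inv (m : 'I_N -> 'M[int]_(g + g)) (A : 'M[int]_N) :
    lattice_basis Gamma (W0 g R) m -> coord_mx m = A *m coord_mx m -> A = 1%:M.
  move=> mB mE; apply/eqP; rewrite -subr_eq0; apply/eqP/row_matrixP => i.
  rewrite row0; apply: (coord_mx_free mB).
  by rewrite -row_mul mulmxBl mul1mx -mE subrr row0.
have [||s PS] := nonneg_inverse_perm (nonneg _ _ _ lB cone_eq PR)
  (nonneg _ _ _ l'B (esym cone_eq) QR).
- by apply: (inv l') => //; rewrite -mulmxA -QE.
- by apply: (inv l) => //; rewrite -mulmxA -PE.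
exists s => k; apply: ucoord_inj; [exact: l'B.1 | exact: lB.1|].
rewrite PS -row_permE in PE.
have /matrixP coordE := PE; apply/rowP => a.
by have := coordE k a; rewrite !mxE.
Qed.

(** Regularity only gives part of a basis of unknown length [n]; a cone spanning
    dimension [N] needs [N] generators, while [n <= N]. *)
Lemma top_cone_basis (S : set (set 'M[R]_(g + g))) s :
  regular_decomposition Gamma (W0 g R) S -> top_cones S s ->
  exists2 l : 'I_N -> 'M[int]_(g + g), lattice_basis Gamma (W0 g R) l &
    s = cone_gen (fun k => intR R (l k)).
Proof.
move=> S_reg [/S_reg [n [l [I [lB ->]]]] [E dimE [_ E_min]]].
have le_NI : (N <= #|I|)%N.
  pose gens := [seq intR R (l k) | k <- enum I].
  rewrite -dimE cardE -(size_map (fun k => intR R (l k))) -/gens.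
  apply: leq_trans (dim_span gens); apply/dimvS/E_min => x [c _ ->] /=.
  apply: memv_suml => k _; apply/memvZ/memv_span/mapP.
  by exists (val k); rewrite // mem_enum (valP k).
have le_In : (#|I| <= n)%N by rewrite -[leqRHS]card_ord max_card.
have nN : n = N.
  by apply/eqP; rewrite eqn_leq (basis_size lB) /= (leq_trans le_NI).
subst n; exists l => //.
have IT k : k \in I.
  suff -> : I = [set: 'I_N]%SET by rewrite finset.in_setT.
  by apply/eqP; rewrite eqEcard finset.subsetT finset.cardsT card_ord.
apply: (cone_gen_reindex (h := val)).
by exists (fun k => exist _ k (IT k)) => // k; apply: val_inj.
Qed.

End UnipotentLattice.

(** * The map to integral points *)

Lemma row_class_row_perm (K : fieldType) g (s : 'S_(symdim g))
    (Z : 'M[K]_(symdim g)) : row_class (row_perm s Z) = row_class Z.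
Proof.
apply/seteqP; split => _ [t _ <-].
  by exists (t * s)%g => //; rewrite row_permM.
by exists (t * s^-1)%g => //; rewrite -row_permM mulgKV.
Qed.

Section Nu.
Variables (R : realType) (g : nat) (Gamma : set 'M[int]_(g + g)).
Hypothesis Gamma1 : Gamma 1%:M.
Implicit Types (s t : set 'M[R]_(g + g)).

Lemma nu_value_uniq s q q' :
  nu_value Gamma s q -> nu_value Gamma s q' -> q = q'.
Proof.
move=> [l [lB -> ->]] [l' [l'B ll' ->]].
have [p lE] := basis_of_cone_unique Gamma1 lB l'B ll'.
rewrite -(row_class_row_perm p (intC R (row_matrix l))); congr row_class.
by apply/matrixP => k a; rewrite !mxE lE.
Qed.

Lemma nu_value_inj s t q : nu_value Gamma s q -> nu_value Gamma t q -> s = t.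
Proof.
move=> [l [lB -> ->]] [l' [l'B -> cE]].
have : row_class (intC R (row_matrix l')) (intC R (row_matrix l')).
  by exists 1%g => //; rewrite row_perm1.
rewrite -cE => -[p _ /matrixP lE].
have l'E : l' =1 l \o p.
  move=> k; apply: (ucoord_inj (l'B.1 k) (lB.1 (p k))).
  by apply/rowP => a; have := lE k a; rewrite !mxE => /intr_inj.
rewrite -(cone_gen_reindex (h := p) (fun k => intR R (l k))).
  by congr cone_gen; apply/funext => k /=; rewrite l'E.
by exists (p^-1)%g => k; rewrite ?permK ?permKV.
Qed.

Lemma nu_value_Qg s q : (1 < g)%N -> nu_value Gamma s q -> Qg_int R[i] g q.
Proof.
move=> g1 [l [lB _ ->]]; split; last by exists (row_matrix l).
exists (intC R (row_matrix l)) => //; apply: Ag_of_det_neq0 => //.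
by rewrite det_map_mx intr_eq0; exact: (det_coord_mx Gamma1 lB).
Qed.

End Nu.

Theorem theorem4p8 (R : realType) (g : nat) (hg : (2 <= g)%N)
    (Gamma : set 'M[int]_(g + g))
    (hGamma : arithmetic_subgroup Gamma) (hneat : neat R Gamma)
    (Sigma : set (set 'M[R]_(g + g)))
    (hadm : admissible (W0 g R) (GammaF_bar Gamma (W0 g R)) Sigma \/
            admissible (W0 g R) (GLgZ_act g R) Sigma)
    (hreg : regular_decomposition Gamma (W0 g R) Sigma)
    (Abar : aspace R) (j : AgGamma R Gamma -> Abar)
    (hcomp : toroidal_compactification Sigma j)
    (hsnc : simple_normal_crossing (~` range j)) :
  exists nu : set 'M[R]_(g + g) -> set 'M[R[i]]_(symdim g),
    [/\ set_fun (top_cones Sigma) (Qg_int R[i] g) nu,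
        set_inj (top_cones Sigma) nu
      & forall s, top_cones Sigma s ->
          forall q, nu s = q <-> nu_value Gamma s q].
Proof.
have Gamma1 : Gamma 1%:M by case: hGamma => _ [].
pose nu s := xget set0 (nu_value (R := R) Gamma s).
have nuP s : top_cones Sigma s -> nu_value Gamma s (nu s).
  move=> /(top_cone_basis Gamma1 hreg) [l lB sE]; apply: xgetPex.
  by exists (row_class (intC R (row_matrix l))), l.
exists nu; split=> [s /nuP|s t /set_mem/nuP sV /set_mem/nuP tV nuE|s /nuP sV q].
- exact: nu_value_Qg.
- by apply: nu_value_inj sV _; rewrite nuE.
- by split=> [<-//|]; apply: nu_value_uniq sV.
Qed.
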